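(* Let $I\subset \mathbb{R}$ be an open interval such that $[0,1]\subset I$ and let $f:I\to\mathbb{R}$ be a twice differentiable function such that $f''$ is bounded and integrable. Then $$\left|\int_0^1 f(t)\,dt-\frac{\sqrt2}{8}f(0)-\left(1-\frac{\sqrt2}{4}\right)f\left(\tfrac12\right)-\frac{\sqrt2}{8}f(1)\right|\le \frac{2-\sqrt2}{48}\,\|f''\|_\infty .$$
   Context: Here $\|f''\|_\infty=\sup_{t\in[0,1]}|f''(t)|$. *)

(* Defs.v *)
From HB Require Import structures.
From mathcomp Require Import all_boot all_order all_algebra.
From mathcomp Require Import all_classical all_reals all_analysis.

Set Implicit Arguments.
Unset Strict Implicit.
Unset Printing Implicit Defensive.

Import Order.TTheory GRing.Theory Num.Theory.
Import numFieldNormedType.Exports.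

Local Open Scope ring_scope.
Local Open Scope classical_set_scope.

(* [sup] is the supremum in [R], which is meaningful only for a nonempty set
   bounded above, and is 0 by convention otherwise. *)
Definition supnorm01 (R : realType) (g : R -> R) : R :=
  sup [set `|g t| | t in `[0, 1]%classic].

(* Main.v *)
Require Import Defs.
From HB Require Import structures.
From mathcomp Require Import all_boot all_order all_algebra.
From mathcomp Require Import all_classical all_reals all_analysis.
From mathcomp Require Import ring lra.

Set Implicit Arguments.
Unset Strict Implicit.
Unset Printing Implicit Defensive.

Import Order.TTheory GRing.Theory Num.Theory.
Import numFieldNormedType.Exports.

Local Open Scope ring_scope.
Local Open Scope classical_set_scope.

(** For [0 <= a <= 1/4] and smooth [f], the error of the rule with weights [a],
    [1 - 2 a], [a] at [0], [1 / 2], [1] is the integral of [f''] against the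
    Peano kernel, which is symmetric about [1 / 2] and equals
    [K t = t ^+ 2 / 2 - a * t] on the left half.  On that half the kernel
    changes sign at [2 * a], and the integral of its absolute value over [0, 1]
    is [1/24 - a/4 + 8/3 a^3].  This is smallest at [a = sqrt 2 / 8], where it
    equals [(2 - sqrt 2) / 48].

    The mean value theorem takes the place of that integral.  The rule is folded
    at [1 / 2] ([three_point_rule_error]): with [F] an antiderivative of [f],
    the function [G t = F t - F (1 - t)] has derivative [g t = f t + f (1 - t)],
    and [g'] is zero at [1 / 2].  On [0, 1/2] the combination
    [Phi t = G t - (t - a) * g t + K t * g' t] has derivative [K t * g'' t], and
    its increment over the interval is the error.  In absolute value that
    increment is at most the increment of an antiderivative of [sup |g''| * |K|]
    ([normr_increment_le], [half_rule_error]).  The fundamental theorem of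
    calculus is applied to the continuous function [f], to turn its integral
    into [F 1 - F 0] ([continuous_antiderivative]). *)

(** Integrating [|phi| <= psi] would require [phi] to be integrable.  Here the
    mean value theorem is applied to [Psi - s * Phi], for [s = 1] and [s = -1],
    so that [phi] may be any derivative. *)
Lemma normr_increment_le (R : realType) (Phi Psi phi psi : R -> R) (a b : R) :
  a <= b ->
  {in `[a, b]%R, forall t : R, is_derive t 1 Phi (phi t)} ->
  {in `[a, b]%R, forall t : R, is_derive t 1 Psi (psi t)} ->
  {in `[a, b]%R, forall t : R, `|phi t| <= psi t} ->
  `|Phi b - Phi a| <= Psi b - Psi a.
Proof.
move=> ab dPhi dPsi phipsi.
have increment_le (s : R) : `|s| <= 1 -> s * (Phi b - Phi a) <= Psi b - Psi a.
  move=> s1.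
  pose D t := Psi t - s * Phi t.
  have dD t : t \in `[a, b]%R -> is_derive t 1 D (psi t - s * phi t).
    move=> tab; have ? := dPhi t tab; have ? := dPsi t tab.
    by apply: is_derive_eq; rewrite /GRing.scale /=; ring.
  have cD : {within `[a, b], continuous D}.
    by apply: derivable_within_continuous => t /dD[].
  have dDoo t : t \in `]a, b[%R -> is_derive t 1 D (psi t - s * phi t).
    by move=> tab; apply: dD; exact: subset_itv_oo_cc.
  have [c cab DE] := MVT_segment ab dDoo cD.
  rewrite -subr_ge0.
  have -> : Psi b - Psi a - s * (Phi b - Phi a) =
      (psi c - s * phi c) * (b - a) by rewrite -DE /D; ring.
  rewrite mulr_ge0 ?subr_ge0// (le_trans (ler_norm _))// normrM.
  by rewrite (le_trans _ (phipsi c cab))// ler_piMl.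
have := increment_le 1; have := increment_le (-1).
rewrite normrN !normr1 => /(_ (lexx _)) lo /(_ (lexx _)) hi.
by rewrite ler_norml; apply/andP; split; lra.
Qed.

(** The kernel [K] is negative on [0, 2 a] and positive on [2 a, 1/2], so the
    bound comes from comparing [Phi] with [P] on the first interval and with
    [- P] on the second, where [P' = - N * K].  The condition [g' (1 / 2) = 0]
    removes the boundary term [K (1 / 2) * g' (1 / 2)]; it holds for functions
    that are symmetric about [1 / 2]. *)
Lemma half_rule_error (R : realType) (a N : R) (G g g' g'' : R -> R) :
  0 <= a -> a <= 1 / 4 ->
  {in `[0, 1/2]%R, forall t : R, is_derive t 1 G (g t)} ->
  {in `[0, 1/2]%R, forall t : R, is_derive t 1 g (g' t)} ->
  {in `[0, 1/2]%R, forall t : R, is_derive t 1 g' (g'' t)} ->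
  {in `[0, 1/2]%R, forall t : R, `|g'' t| <= N} ->
  g' (1 / 2) = 0 ->
  `|G (1 / 2) - G 0 - a * g 0 - (1 / 2 - a) * g (1 / 2)|
    <= (1 / 48 - a / 8 + 4 / 3 * a ^+ 3) * N.
Proof.
move=> a0 a4 dG dg dg' g''N g'0.
pose K t : R := 2^-1 * t ^+ 2 - a * t.
pose Phi t : R := G t - (t - a) * g t + K t * g' t.
pose P t : R := N * (a / 2 * t ^+ 2 - 6^-1 * t ^+ 3).
have dK (t : R) : is_derive t 1 K (t - a).
  by rewrite /K; apply: is_derive_eq;
    rewrite /GRing.scale /=; field.
have dP (t : R) : is_derive t 1 P (N * - K t).
  by rewrite /P; apply: is_derive_eq;
    rewrite /K /GRing.scale /=; field.
have dPhi (t : R) : t \in `[0, 1/2]%R -> is_derive t 1 Phi (K t * g'' t).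
  move=> t01; have ? := dG _ t01; have ? := dg _ t01; have ? := dg' _ t01.
  by rewrite /Phi; apply: is_derive_eq; rewrite /GRing.scale /=; ring.
have KE t : K t = t * (t - 2 * a) / 2 by rewrite /K; field.
have left : `|Phi (2 * a) - Phi 0| <= P (2 * a) - P 0.
  apply: (@normr_increment_le R Phi P (fun t => K t * g'' t)
           (fun t => N * - K t) 0 (2 * a)).
  - lra.
  - by move=> t; rewrite in_itv/= => ?; apply: dPhi; rewrite in_itv/=; lra.
  - by move=> t _; exact: dP.
  - move=> t; rewrite in_itv/= => ta.
    have K0 : K t <= 0 by rewrite KE; nra.
    rewrite normrM ler0_norm// mulrC ler_wpM2r ?oppr_ge0// g''N//.
    by rewrite in_itv/=; lra.
have right : `|Phi (1 / 2) - Phi (2 * a)| <= - P (1 / 2) - - P (2 * a).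
  apply: (@normr_increment_le R Phi (fun t => - P t)
           (fun t => K t * g'' t) (fun t => N * K t) (2 * a) (1 / 2)).
  - lra.
  - by move=> t; rewrite in_itv/= => ?; apply: dPhi; rewrite in_itv/=; lra.
  - move=> t _; have ? := dP t.
    by apply: is_derive_eq; rewrite mulrN opprK.
  - move=> t; rewrite in_itv/= => ta.
    have K0 : 0 <= K t by rewrite KE; nra.
    rewrite normrM ger0_norm// mulrC ler_wpM2r// g''N//.
    by rewrite in_itv/=; lra.
have -> : G (1 / 2) - G 0 - a * g 0 - (1 / 2 - a) * g (1 / 2)
    = (Phi (1 / 2) - Phi (2 * a)) + (Phi (2 * a) - Phi 0).
  by rewrite /Phi g'0 /K; ring.
rewrite (le_trans (ler_normD _ _))// (le_trans (lerD right left))//.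
by rewrite le_eqVlt; apply/orP; left; apply/eqP; rewrite /P; field.
Qed.

Lemma is_derive_reflect (R : realType) (g : R -> R) (dg t : R) :
  is_derive (1 - t) 1 g dg -> is_derive t 1 (fun t => g (1 - t)) (- dg).
Proof.
move=> gdg; have dr : is_derive t 1 (fun t : R => 1 - t) (- 1).
  by apply: is_derive_eq; rewrite add0r mul1r.
by rewrite -mulrN1; exact: (@is_derive1_comp R g (fun t => 1 - t)).
Qed.

(** The factor of [M] is the integral of the absolute Peano kernel on [0, 1], for
    every [a] such that the kernel's zero [2 a] does not exceed [1 / 2]. *)
Lemma three_point_rule_error (R : realType) (a M : R) (F f f' f'' : R -> R) :
  0 <= a -> a <= 1 / 4 ->
  {in `[0, 1]%R, forall t : R, is_derive t 1 F (f t)} ->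
  {in `[0, 1]%R, forall t : R, is_derive t 1 f (f' t)} ->
  {in `[0, 1]%R, forall t : R, is_derive t 1 f' (f'' t)} ->
  {in `[0, 1]%R, forall t : R, `|f'' t| <= M} ->
  `|F 1 - F 0 - a * f 0 - (1 - 2 * a) * f (1 / 2) - a * f 1|
    <= (1 / 24 - a / 4 + 8 / 3 * a ^+ 3) * M.
Proof.
move=> a0 a4 dF df df' f''M.
have sub01 (t : R) : t \in `[0, 1/2]%R ->
    t \in `[0, 1]%R /\ 1 - t \in `[0, 1]%R.
  by rewrite !in_itv/=; split; lra.
have half : 1 - 1 / 2 = 1 / 2 :> R by field.
(* Folding at [1 / 2] doubles the bound on the second derivative. *)
have := @half_rule_error R a (2 * M) (fun t => F t - F (1 - t))
  (fun t => f t + f (1 - t)) (fun t => f' t - f' (1 - t))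
  (fun t => f'' t + f'' (1 - t)) a0 a4.
rewrite half subr0 !subrr => main.
have -> : F 1 - F 0 - a * f 0 - (1 - 2 * a) * f (1 / 2) - a * f 1 =
  0 - (F 0 - F 1) - a * (f 0 + f 1) - (1 / 2 - a) * (f (1 / 2) + f (1 / 2)).
  by field.
have -> : (1 / 24 - a / 4 + 8 / 3 * a ^+ 3) * M =
  (1 / 48 - a / 8 + 4 / 3 * a ^+ 3) * (2 * M) by field.
apply: main => // t /sub01[t01 r01].
- have -> : f t + f (1 - t) = f t - - f (1 - t) by rewrite opprK.
  exact: is_deriveB (dF t t01) (is_derive_reflect (dF _ r01)).
- exact: is_deriveD (df t t01) (is_derive_reflect (df _ r01)).
- have -> : f'' t + f'' (1 - t) = f'' t - - f'' (1 - t) by rewrite opprK.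
  exact: is_deriveB (df' t t01) (is_derive_reflect (df' _ r01)).
- by rewrite (le_trans (ler_normD _ _))// mulr_natl mulr2n lerD// f''M.
Qed.

(** The integral is started at a point [u < a] and [f] is integrable up to some
    [v > b]; this makes [F] differentiable on both sides at the endpoints [a]
    and [b]. *)
Lemma continuous_antiderivative (R : realType) (I : set R) (f : R -> R)
    (a b : R) :
  a < b -> open I -> `[a, b] `<=` I ->
  (forall x, I x -> {for x, continuous f}) ->
  exists F : R -> R, {in `[a, b]%R, forall x : R, is_derive x 1 F (f x)} /\
    \int[@lebesgue_measure R]_(t in `[a, b]) f t = F b - F a.
Proof.
move=> ab oI abI cf.
have nearI x : x \in `[a, b]%R -> exists2 e : R, 0 < e & ball x e `<=` I.
  move=> xab; have /nbhs_ballP[e e0 ?] : nbhs x I.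
    by apply: open_nbhs_nbhs; split => //; exact: abI.
  by exists e.
have [d d0 dI] := nearI a ltac:(by rewrite in_itv/= lexx ltW).
have [e e0 eI] := nearI b ltac:(by rewrite in_itv/= lexx ltW).
pose u := a - d / 2; pose v := b + e / 2.
have uvI : `[u, v] `<=` I.
  move=> x /=; rewrite in_itv/= /u /v => uxv.
  have [xa|ax] := ltP x a.
    by apply: dI; rewrite /ball/= ger0_norm; lra.
  have [bx|xb] := ltP b x.
    by apply: eI; rewrite /ball/= ler0_norm; lra.
  by apply: abI; rewrite /= in_itv/= ax.
have fint : (@lebesgue_measure R).-integrable `[u, v] (EFin \o f).
  apply: continuous_compact_integrable; first exact: segment_compact.
  by apply: continuous_in_subspaceT => x /set_mem/uvI/cf.
pose F (x : R) : R := \int[@lebesgue_measure R]_(t in `[u, x]) f t.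
have dF x : x \in `[a, b]%R -> derivable F x 1 /\ F^`() x = f x.
  move=> xab; apply: (continuous_FTC1_closed _ fint).
  - by move: xab; rewrite in_itv/= /v; lra.
  - by move: xab; rewrite in_itv/= /u; lra.
  - exact/cf/abI.
have dFab x : x \in `[a, b]%R -> is_derive x 1 F (f x).
  by move=> /dF[dFx <-]; rewrite derive1E; exact/derivableP.
exists F; split => //.
rewrite /Rintegral (@continuous_FTC2 _ _ F)//.
- by apply: continuous_in_subspaceT => x /set_mem/abI/cf.
- have cF : {within `[a, b], continuous F}.
    by apply: derivable_within_continuous => x /dF[].
  have [_ ? ?] := (continuous_within_itvP _ ab).1 cF; split => // x xab.
  by have [] := dF x (subset_itv_oo_cc xab).
- by move=> x /subset_itv_oo_cc/dF[].
Qed.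

(** Boundedness on a set containing [0, 1] makes the supremum a true one rather
    than the default value of [sup]. *)
Lemma le_supnorm01 (R : realType) (g : R -> R) (I : set R) (t : R) :
  `[0, 1] `<=` I -> [bounded g x | x in I] -> t \in `[0, 1]%R ->
  `|g t| <= supnorm01 g.
Proof.
move=> sI bg t01; apply: sup_ubound; last by exists t.
have [M [_ gM]] := bg; exists (M + 1) => _ [x /sI Ix <-].
by apply: (gM (M + 1)) => //; rewrite ltrDl.
Qed.

Theorem theorem1 (R : realType) (I : set R) (f : R -> R)
  (openI : open I) (intervalI : is_interval I)
  (sub01I : `[0, 1]%classic `<=` I)
  (df : forall x, I x -> derivable f x 1)
  (ddf : forall x, I x -> derivable f^`() x 1)
  (bounded_f'' : [bounded f^`()^`() x | x in I])
  (integrable_f'' :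
    (@lebesgue_measure R).-integrable `[0, 1] (EFin \o f^`()^`())) :
  `| \int[@lebesgue_measure R]_(t in `[0, 1]) f t
     - Num.sqrt 2 / 8 * f 0
     - (1 - Num.sqrt 2 / 4) * f (1 / 2)
     - Num.sqrt 2 / 8 * f 1 |
  <= (2 - Num.sqrt 2) / 48 * supnorm01 f^`()^`().
Proof.
have cf x : I x -> {for x, continuous f}.
  by move=> /df/derivable1_diffP; exact: differentiable_continuous.
have [F [dF ->]] := continuous_antiderivative ltr01 openI sub01I cf.
set s := Num.sqrt 2.
have s2 : s ^+ 2 = 2 by rewrite sqr_sqrtr.
have s0 : 0 <= s by exact: sqrtr_ge0.
have -> : 1 - s / 4 = 1 - 2 * (s / 8) by field.
have -> : (2 - s) / 48 = 1 / 24 - s / 8 / 4 + 8 / 3 * (s / 8) ^+ 3.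
  by rewrite expr_div_n exprS s2; field.
apply: (three_point_rule_error (f' := f^`()) (f'' := f^`()^`())).
- by rewrite divr_ge0.
- nra.
- exact: dF.
- by move=> t /sub01I/df ?; rewrite derive1E; exact/derivableP.
- by move=> t /sub01I/ddf ?; rewrite derive1E; exact/derivableP.
- by move=> t; exact: le_supnorm01 bounded_f''.
Qed.
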